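(* Let $\tau\subset\mathbb{R}^4$ (coordinates $(w,x,y,z)$) be the convex hull of $A=(-\frac12,-\frac12,-\frac12,-\frac12)$, $B=(\frac12,-\frac12,-\frac12,-\frac12)$, $C=(\frac12,\frac12,-\frac12,-\frac12)$, $D=(\frac12,\frac12,\frac12,-\frac12)$, $E=(\frac12,\frac12,\frac12,\frac12)$, which is a translate of $\mathcal{O}_4$. Cut $\tau$ along the hyperplanes $w+y+z=-\frac12$ and $w+x+z=\frac12$ into three pieces: $\tau_1$ (containing $A$, where $w+y+z\le-\frac12$), $\tau_3$ (containing $E$, where $w+x+z\ge\frac12$), and the central piece $\tau_2$ (where $w+y+z\ge-\frac12$ and $w+x+z\le\frac12$). Define the isometries $$\alpha(w,x,y,z)=(-y,-x,-w,-1-z),\quad \beta(w,x,y,z)=(1-w,-z,-y,-x),\quad \gamma(w,x,y,z)=(x,y,z,w-1).$$ Then $\alpha(\tau_1)$, $\tau_2$, $\beta(\tau_3)$ have pairwise disjoint interiors. Let $\tau_4$ be their union, and cut it along the hyperplane $w+x+y+z=0$ into $\tau_5$ (where $w+x+y+z\le0$) and $\tau_6$ (where $w+x+y+z\ge0$). Then $\tau_5$ and $\gamma(\tau_6)$ have disjoint interiors, and their union $\tau_7$ is congruent to the prism $\sqrt{\tfrac34}\,\mathcal{P}_3\times I_{1/2}$. Consequently these three cuts give a six-piece dissection of $\mathcal{O}_4$ into $\sqrt{\tfrac34}\,\mathcal{P}_3\times I_{1/2}$.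
   Context: $\mathcal{O}_4$ is the simplex with vertices $0000,1000,1100,1110,1111$ in $\mathbb{R}^4$. $\mathcal{P}_3$ is the tetrahedron $\{\lambda_1v_1+\lambda_2v_2+\lambda_3v_3: 1\ge\lambda_1\ge\lambda_2\ge\lambda_3\ge0\}$, where $v_1,v_2,v_3$ are unit vectors in $\mathbb{R}^3$ with $v_i\cdot v_j=-\frac13$ for $i\ne j$ (unique up to isometry). $\sqrt{\frac34}\,\mathcal{P}_3$ is its copy scaled by $\sqrt{3/4}$, and $I_{1/2}$ is an interval of length $\frac12$. A polytope in $\mathbb{R}^n$ is a union of finitely many bounded $n$-dimensional simplices. A six-piece dissection of a polytope $P$ into a polytope $Q$ consists of polytopes $P_1,\dots,P_6$ with pairwise disjoint interiors and union $P$, polytopes $Q_1,\dots,Q_6$ with pairwise disjoint interiors and union $Q$, and isometries $g_i$ (possibly orientation-reversing) with $g_i(P_i)=Q_i$. *)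

(* Defs.v *)
From HB Require Import structures.
From mathcomp Require Import all_boot all_order all_algebra.
From mathcomp Require Import all_classical all_reals all_analysis.
From mathcomp Require Import ring.

Set Implicit Arguments.
Unset Strict Implicit.
Unset Printing Implicit Defensive.

Import Order.TTheory GRing.Theory Num.Theory.
Import numFieldNormedType.Exports.

Local Open Scope classical_set_scope.
Local Open Scope ring_scope.

(* R^n is 'rV[R]_n. The library's norm on 'rV[R]_n is the sup norm, so the
   Euclidean metric is defined here; both induce the same topology, hence the
   library's interior A° is the Euclidean one. *)

Definition dotv (R : realType) (n : nat) (u v : 'rV[R]_n) : R :=
  \sum_i u ord0 i * v ord0 i.

Definition enorm (R : realType) (n : nat) (u : 'rV[R]_n) : R :=
  Num.sqrt (dotv u u).

Definition edist (R : realType) (n : nat) (u v : 'rV[R]_n) : R := enorm (u - v).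

(* Orientation-reversing maps are allowed. *)
Definition euclidean_isometry (R : realType) (n : nat) (g : 'rV[R]_n -> 'rV[R]_n) : Prop :=
  forall u v, edist (g u) (g v) = edist u v.

Definition congruent (R : realType) (n : nat) (A B : set 'rV[R]_n) : Prop :=
  exists2 g, euclidean_isometry g & g @` A = B.

Definition hull (R : realType) (n k : nat) (p : k.-tuple 'rV[R]_n) :
    set 'rV[R]_n :=
  [set x | exists l : 'I_k -> R,
     [/\ forall i, 0 <= l i, \sum_i l i = 1 & x = \sum_i l i *: tnth p i]].

Definition affinely_independent (R : realType) (n k : nat)
    (p : k.+1.-tuple 'rV[R]_n) : bool :=
  row_free (\matrix_(i < k) (tnth p (lift ord0 i) - tnth p ord0)).

(* The family of simplices is required to be nonempty, so that the empty set
   is not a polytope and a dissection into k pieces has k nonempty pieces. *)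
Definition polytope (R : realType) (n : nat) (P : set 'rV[R]_n) : Prop :=
  exists s : seq (n.+1.-tuple 'rV[R]_n),
    [/\ s != [::], all (@affinely_independent R n n) s &
        P = \bigcup_(p in [set` s]) hull p].

Definition tiling (R : realType) (n k : nat) (P : set 'rV[R]_n)
    (Ps : 'I_k -> set 'rV[R]_n) : Prop :=
  trivIset setT (fun i => (Ps i)°) /\ \bigcup_i Ps i = P.

Definition dissection (R : realType) (n k : nat) (P Q : set 'rV[R]_n)
    (Ps Qs : 'I_k -> set 'rV[R]_n) (g : 'I_k -> 'rV[R]_n -> 'rV[R]_n) : Prop :=
  [/\ polytope P /\ polytope Q,
      forall i, polytope (Ps i) /\ polytope (Qs i),
      tiling P Ps, tiling Q Qs &
      forall i, euclidean_isometry (g i) /\ g i @` Ps i = Qs i].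

Definition pt4 (R : realType) (w x y z : R) : 'rV[R]_4 :=
  \row_i tnth [tuple w; x; y; z] i.

Definition wc (R : realType) (p : 'rV[R]_4) : R := p ord0 (@Ordinal 4 0 isT).
Definition xc (R : realType) (p : 'rV[R]_4) : R := p ord0 (@Ordinal 4 1 isT).
Definition yc (R : realType) (p : 'rV[R]_4) : R := p ord0 (@Ordinal 4 2 isT).
Definition zc (R : realType) (p : 'rV[R]_4) : R := p ord0 (@Ordinal 4 3 isT).

Definition hill_vectors (R : realType) (v1 v2 v3 : 'rV[R]_3) : Prop :=
  [/\ enorm v1 = 1, enorm v2 = 1 & enorm v3 = 1] /\
  [/\ dotv v1 v2 = - 3^-1, dotv v1 v3 = - 3^-1 & dotv v2 v3 = - 3^-1].

Lemma hill_vectors_exist (R : realType) :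
  exists v1 v2 v3 : 'rV[R]_3, hill_vectors v1 v2 v3.
Proof.
pose v (a b c : R) : 'rV[R]_3 :=
  (Num.sqrt 3)^-1 *: \row_i tnth [tuple a; b; c] i.
have dv a b c a' b' c' :
    dotv (v a b c) (v a' b' c') = 3^-1 * (a * a' + b * b' + c * c').
  rewrite /dotv !big_ord_recl big_ord0 !mxE /= !(tnth_nth 0) /= addr0.
  have <- : (Num.sqrt 3)^-1 * (Num.sqrt 3)^-1 = 3^-1 :> R.
    by rewrite -invfM -expr2 sqr_sqrtr ?ler0n.
  ring.
have nv a b c : a * a + b * b + c * c = 3 -> enorm (v a b c) = 1.
  by move=> h; rewrite /enorm dv h mulVf ?sqrtr1// pnatr_eq0.
exists (v 1 (-1) (-1)), (v (-1) 1 (-1)), (v (-1) (-1) 1).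
have e (x : R) : x = -1 -> 3^-1 * x = - 3^-1 by move=> ->; rewrite mulrN1.
by split; split; rewrite ?dv; (apply: nv || apply: e); ring.
Qed.

Definition P3 (R : realType) (v1 v2 v3 : 'rV[R]_3) : set 'rV[R]_3 :=
  [set u | exists l1 l2 l3 : R, [/\ 1 >= l1, l1 >= l2, l2 >= l3, l3 >= 0 &
     u = l1 *: v1 + l2 *: v2 + l3 *: v3]].

(* A `x I inside R^3 x R = R^4, the last coordinate being the R factor. *)
Definition prism (R : realType) (A : set 'rV[R]_3) (I : set R) :
    set 'rV[R]_4 :=
  [set p | exists u t, [/\ A u, I t & p = row_mx u (const_mx t : 'rV[R]_1)]].

Unset Implicit Arguments.

Definition O4 (R : realType) : set 'rV[R]_4 :=
  hull [tuple pt4 0 0 0 0; pt4 1 0 0 0; pt4 1 1 0 0; pt4 1 1 1 0; pt4 1 1 1 1].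

Definition ptA (R : realType) : 'rV[R]_4 := pt4 (- 2^-1) (- 2^-1) (- 2^-1) (- 2^-1).
Definition ptB (R : realType) : 'rV[R]_4 := pt4 2^-1 (- 2^-1) (- 2^-1) (- 2^-1).
Definition ptC (R : realType) : 'rV[R]_4 := pt4 2^-1 2^-1 (- 2^-1) (- 2^-1).
Definition ptD (R : realType) : 'rV[R]_4 := pt4 2^-1 2^-1 2^-1 (- 2^-1).
Definition ptE (R : realType) : 'rV[R]_4 := pt4 2^-1 2^-1 2^-1 2^-1.

Definition tau (R : realType) : set 'rV[R]_4 :=
  hull [tuple ptA R; ptB R; ptC R; ptD R; ptE R].

Definition tau1 (R : realType) : set 'rV[R]_4 :=
  tau R `&` [set p | wc p + yc p + zc p <= - 2^-1].

Definition tau2 (R : realType) : set 'rV[R]_4 :=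
  tau R `&`
  [set p | wc p + yc p + zc p >= - 2^-1 /\ wc p + xc p + zc p <= 2^-1].

Definition tau3 (R : realType) : set 'rV[R]_4 :=
  tau R `&` [set p | wc p + xc p + zc p >= 2^-1].

Definition alpha (R : realType) (p : 'rV[R]_4) : 'rV[R]_4 :=
  pt4 (- yc p) (- xc p) (- wc p) (- 1 - zc p).

Definition beta (R : realType) (p : 'rV[R]_4) : 'rV[R]_4 :=
  pt4 (1 - wc p) (- zc p) (- yc p) (- xc p).

Definition gamma (R : realType) (p : 'rV[R]_4) : 'rV[R]_4 :=
  pt4 (xc p) (yc p) (zc p) (wc p - 1).

Definition tau4 (R : realType) : set 'rV[R]_4 :=
  alpha R @` tau1 R `|` tau2 R `|` beta R @` tau3 R.

Definition tau5 (R : realType) : set 'rV[R]_4 :=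
  tau4 R `&` [set p | wc p + xc p + yc p + zc p <= 0].

Definition tau6 (R : realType) : set 'rV[R]_4 :=
  tau4 R `&` [set p | wc p + xc p + yc p + zc p >= 0].

Definition tau7 (R : realType) : set 'rV[R]_4 :=
  tau5 R `|` gamma R @` tau6 R.

(* The cut of tau4 along w+x+y+z=0, pulled back to tau1, tau2 and tau3, cuts
   each of them in two; final_motion i carries the piece tau_piece i into
   tau7. *)
Definition tau_piece (R : realType) (i : 'I_6) : set 'rV[R]_4 :=
  tnth [tuple tau1 R `&` alpha R @^-1` tau5 R;
              tau1 R `&` alpha R @^-1` tau6 R;
              tau2 R `&` tau5 R;
              tau2 R `&` tau6 R;
              tau3 R `&` beta R @^-1` tau5 R;
              tau3 R `&` beta R @^-1` tau6 R] i.

Definition final_motion (R : realType) (i : 'I_6) : 'rV[R]_4 -> 'rV[R]_4 :=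
  tnth [tuple alpha R; gamma R \o alpha R;
              id; gamma R;
              beta R; gamma R \o beta R] i.

(* Translation taking O4 to tau. *)
Definition to_tau (R : realType) (p : 'rV[R]_4) : 'rV[R]_4 :=
  p - const_mx 2^-1.

(* Main.v *)
Require Import Defs.
From HB Require Import structures.
From mathcomp Require Import all_boot all_order all_algebra.
From mathcomp Require Import all_classical all_reals all_analysis.
From mathcomp Require Import ring lra.

Set Implicit Arguments.
Unset Strict Implicit.
Unset Printing Implicit Defensive.

Import Order.TTheory GRing.Theory Num.Theory.
Import numFieldNormedType.Exports.

Local Open Scope classical_set_scope.
Local Open Scope ring_scope.

(** The simplex is tau = {-1/2 <= z <= y <= x <= w <= 1/2}. Solving the
    inequalities case by case, the reassembled tau4 is the convex set
      w >= x >= y >= z,  y >= -1/2,  x <= 1/2,  w <= 1 + z,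
      w + y + z >= -1/2,  w + x + z <= 1/2,
    and tau7 is {1 + z >= w >= x >= y >= z, -1 <= w + x + y + z <= 0}, a slab of
    thickness 1/2 orthogonal to (1,1,1,1). The projections u1, ..., u4 of the
    standard basis to the hyperplane w + x + y + z = 0 have squared norm 3/4,
    mutual dot product -1/4 and sum 0, so the cross-section, which consists of
    (w - z) u1 + (x - z) u2 + (y - z) u3 with 1 >= w - z >= x - z >= y - z >= 0,
    is a copy of sqrt(3/4) P3.

    Interiors are disjoint because each pair of pieces is separated by a
    hyperplane. The pieces are polytopes because a convex polytope cut by a
    halfspace whose interior meets it is again a polytope. *)

(** * Euclidean isometries *)

(** Neighbourhoods of matrices are given entrywise, and each entry of [u *m M] is a finite sum of
    coordinates of [u] times constants. *)
Lemma mulmxr_continuous (R : realType) m n (M : 'M[R]_(m, n)) :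
  continuous (fun u : 'rV[R]_m => u *m M).
Proof.
have hc i j : continuous (fun u : 'rV[R]_m => \sum_k u i k * M k j).
  apply: continuous_big => [|k _ x]; first exact: add_continuous.
  exact: (@cvgMr_tmp _ _ (nbhs x) _ _ _ _ (@coord_continuous _ _ _ _ _ x)).
move=> x A [P nP PA]; have FF := nbhs_filter (x : 'rV[R]_m).
have hP i j : \forall u \near nbhs x, P i j ((u *m M) i j).
  have := nP i j; rewrite mxE => /(hc i j x) h; apply: (@filterS _ _ FF _ _ _ h) => u /=.
  by rewrite [(u *m M) i j]mxE.
have h i := @filter_forall _ _ _ _ FF (hP i).
have {}h := @filter_forall _ _ _ _ FF h.
by apply: (@filterS _ _ FF _ _ _ h) => u; exact: PA.
Qed.

Section Isometry.
Variables (R : realType) (n : nat).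
Implicit Types (u v : 'rV[R]_n) (g : 'rV[R]_n -> 'rV[R]_n).

Lemma dotvE u v : dotv u v = (u *m v^T) 0 0.
Proof. by rewrite mxE; apply: eq_bigr => i _; rewrite mxE. Qed.

Lemma dotvC u v : dotv u v = dotv v u.
Proof. by apply: eq_bigr => i _; rewrite mulrC. Qed.

Lemma dotvDr u v w : dotv u (v + w) = dotv u v + dotv u w.
Proof. by rewrite -big_split; apply: eq_bigr => i _; rewrite mxE mulrDr. Qed.

Lemma dotvZr u k v : dotv u (k *: v) = k * dotv u v.
Proof. by rewrite mulr_sumr; apply: eq_bigr => i _; rewrite mxE mulrCA. Qed.

Lemma dotvNr u v : dotv u (- v) = - dotv u v.
Proof. by rewrite -scaleN1r dotvZr mulN1r. Qed.

Lemma dotvDl u v w : dotv (u + v) w = dotv u w + dotv v w.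
Proof. by rewrite dotvC dotvDr !(dotvC w). Qed.

Lemma dotvZl k u v : dotv (k *: u) v = k * dotv u v.
Proof. by rewrite dotvC dotvZr dotvC. Qed.

Lemma dotvNl u v : dotv (- u) v = - dotv u v.
Proof. by rewrite dotvC dotvNr dotvC. Qed.

Lemma dotv_sumr (I : finType) u (F : I -> 'rV[R]_n) :
  dotv u (\sum_i F i) = \sum_i dotv u (F i).
Proof.
rewrite /dotv exchange_big /=; apply: eq_bigr => j _.
by rewrite summxE mulr_sumr.
Qed.

Lemma dotvv_ge0 u : 0 <= dotv u u.
Proof. by apply: sumr_ge0 => i _; rewrite -expr2 sqr_ge0. Qed.

Lemma dotvv_eq0 u : (dotv u u == 0) = (u == 0).
Proof.
apply/idP/eqP => [|->]; last by rewrite /dotv big1 // => i _; rewrite mxE mul0r.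
rewrite psumr_eq0 => [/allP h|i _]; last by rewrite -expr2 sqr_ge0.
apply/rowP => i; have := h i (mem_index_enum _).
by rewrite mxE mulf_eq0 orbb => /eqP.
Qed.

Lemma isometryP g :
  euclidean_isometry g <->
  forall u v, dotv (g u - g v) (g u - g v) = dotv (u - v) (u - v).
Proof.
split=> h u v; last by rewrite /Defs.edist /enorm h.
by apply/eqP; rewrite -eqr_sqrt ?dotvv_ge0 //; apply/eqP/h.
Qed.

(* Polarization shows that [u |-> g u - g 0] preserves the dot product, so its
   matrix [M] has orthonormal rows, and [g u - g 0] has the same dot product as
   [u *m M] with every row of [M]. *)
Lemma isometry_mx g : euclidean_isometry g ->
  exists2 M, M *m M^T = 1%:M & forall u, g u = u *m M + g 0.
Proof.
move/isometryP => hg.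
have hd u v : dotv (g u - g 0) (g v - g 0) = dotv u v.
  have e1 := hg u v; have e2 := hg u 0; have e3 := hg v 0.
  have e : g u - g v = (g u - g 0) - (g v - g 0) by rewrite opprB addrA subrK.
  move: e1 e2 e3; rewrite e !subr0.
  move: (g u - g 0) (g v - g 0) => x y.
  rewrite !(dotvDl, dotvDr, dotvNl, dotvNr) (dotvC y x) (dotvC v u).
  by move=> e1 e2 e3; lra.
pose M : 'M[R]_n := \matrix_i (g (delta_mx 0 i) - g 0).
have dM u i : dotv (u *m M) (row i M) = u 0 i.
  rewrite mulmx_sum_row dotvC dotv_sumr (bigD1 i) //= dotvZr !rowK hd.
  rewrite big1 ?addr0 => [|j ji].
    by rewrite dotvE trmx_delta mul_delta_mx mxE !eqxx mulr1.
  rewrite dotvZr rowK hd dotvE trmx_delta mul_delta_mx_cond.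
  by rewrite eq_sym (negPf ji) mxE mulr0.
have MM : M *m M^T = 1%:M.
  apply/matrixP => i j.
  have := dM (delta_mx 0 i) j; rewrite -rowE !mxE eqxx /= eq_sym => <-.
  by apply: eq_bigr => k _; rewrite !mxE.
exists M => // u; apply/eqP; rewrite -subr_eq -subr_eq0 -dotvv_eq0.
have gM : dotv (u *m M) (g u - g 0) = dotv u u.
  rewrite mulmx_sum_row dotvC dotv_sumr; apply: eq_bigr => i _.
  rewrite dotvZr rowK hd; congr (_ * _).
  by rewrite dotvE trmx_delta -colE mxE.
have Mu : dotv (u *m M) (u *m M) = dotv u u.
  by rewrite !dotvE trmx_mul mulmxA -(mulmxA u) MM mulmx1.
move: (hd u u) gM Mu; move: (g u - g 0) (u *m M) => x y xx yx yy.
by rewrite !(dotvDl, dotvDr, dotvNl, dotvNr) xx (dotvC x) yx yy; apply/eqP; ring.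
Qed.

(** Since [M] is square, [M *m M^T = 1] also gives [M^T *m M = 1]; this is where surjectivity comes
    from. *)
Lemma isometry_inv g : euclidean_isometry g ->
  exists g', [/\ euclidean_isometry g', cancel g g' & cancel g' g].
Proof.
move=> hg; have [M MM gE] := isometry_mx hg.
have gg' v : g ((v - g 0) *m M^T) = v.
  by rewrite gE -mulmxA (mulmx1C MM) mulmx1 subrK.
exists (fun v => (v - g 0) *m M^T); split=> [u v|u|//].
  by rewrite -(hg _ _) !gg'.
by rewrite gE addrK -mulmxA MM mulmx1.
Qed.

Lemma isometry_injective g : euclidean_isometry g -> injective g.
Proof. by case/isometry_inv => g' [_ /can_inj]. Qed.

Lemma isometry_comp f g :
  euclidean_isometry f -> euclidean_isometry g -> euclidean_isometry (f \o g).
Proof. by move=> hf hg u v; rewrite hf hg. Qed.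

Lemma isometry_sum g k (l : 'I_k -> R) (p : 'I_k -> 'rV[R]_n) :
  euclidean_isometry g -> \sum_i l i = 1 ->
  g (\sum_i l i *: p i) = \sum_i l i *: g (p i).
Proof.
move=> hg l1; have [M _ gE] := isometry_mx hg.
under [RHS]eq_bigr do rewrite gE scalerDr scalemxAl.
by rewrite gE mulmx_suml big_split -scaler_suml l1 scale1r.
Qed.

Lemma isometry_continuous g : euclidean_isometry g -> continuous g.
Proof.
move=> hg; have [M _ gE] := isometry_mx hg.
rewrite (_ : g = fun u => u *m M + g 0); last exact/funext.
move=> x; apply: (@cvgD _ _ _ (nbhs x) _ (fun u => u *m M) (fun=> g 0) (x *m M) (g 0)).
  exact: mulmxr_continuous.
exact: cvg_cst.
Qed.

End Isometry.

(** * Convex hulls and simplices *)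

Section Hull.
Variables (R : realType) (n : nat).
Implicit Types (k : nat) (u v c : 'rV[R]_n) (P Q : set 'rV[R]_n).

Definition convex P :=
  forall x y t, P x -> P y -> 0 <= t <= 1 -> P (x + t *: (y - x)).

Definition halfspace c (d : R) : set 'rV[R]_n := [set x | d <= dotv c x].

Lemma convexI P Q : convex P -> convex Q -> convex (P `&` Q).
Proof.
move=> cP cQ x y t [Px Qx] [Py Qy] ht; split; [exact: cP|exact: cQ].
Qed.

Lemma convex_halfspace c d : convex (halfspace c d).
Proof.
move=> x y t; rewrite /halfspace /= dotvDr dotvZr dotvDr dotvNr => hx hy /andP[t0 t1].
by nra.
Qed.

Lemma convex_hull k (p : k.-tuple 'rV[R]_n) : convex (hull p).
Proof.
move=> x y t [l [l0 l1 ->]] [m [m0 m1 ->]] /andP[t0 t1].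
exists (fun i => l i + t * (m i - l i)); split=> [i||].
- by have := l0 i; have := m0 i; nra.
- by rewrite big_split /= -mulr_sumr sumrB l1 m1 subrr mulr0 addr0.
- rewrite -sumrB scaler_sumr -big_split; apply: eq_bigr => i _ /=.
  by rewrite -scalerBl scalerA scalerDl.
Qed.

(** The hull is the linear image of the standard simplex, which is compact as a closed subset of the
    cube [0,1]^k. *)
Lemma hull_closed k (p : k.-tuple 'rV[R]_n) : closed (hull p).
Proof.
pose S := [set l : 'rV[R]_k | (forall i, 0 <= l 0 i) /\ \sum_i l 0 i = 1].
pose M := \matrix_i tnth p i.
have -> : hull p = (fun l => l *m M) @` S.
  apply/seteqP; split=> x /=.
    move=> [l [l0 l1 ->]]; exists (\row_i l i).
      by split=> [i|]; [|rewrite -[RHS]l1; apply: eq_bigr => i _]; rewrite mxE.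
    by rewrite mulmx_sum_row; apply: eq_bigr => i _; rewrite mxE rowK.
  move=> [l [l0 l1] <-]; exists (fun i => l 0 i); split=> //.
  by rewrite mulmx_sum_row; apply: eq_bigr => i _; rewrite rowK.
apply: compact_closed; first exact: norm_hausdorff.
apply: continuous_compact.
  by apply: continuous_subspaceT => l; exact: mulmxr_continuous.
pose box := [set l : 'rV[R]_k | forall i, `[0, 1]%classic (l ord0 i)].
apply: (@subclosed_compact _ _ box).
- rewrite (_ : S = \bigcap_i [set l | 0 <= l 0 i] `&` [set l | \sum_i l 0 i = 1]).
    apply: closedI.
      apply: closed_bigI => i _.
      apply: (@closed_comp _ _ (fun l : 'rV[R]_k => l 0 i) [set x | 0 <= x]).
        by move=> l _; exact: coord_continuous.
      exact: closed_ge.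
    apply: (@closed_comp _ _ (fun l : 'rV[R]_k => \sum_i l 0 i) [set x | x = 1]).
      move=> l _; apply: continuous_big => [|i _]; first exact: add_continuous.
      exact: coord_continuous.
    exact: closed_eq.
  by apply/seteqP; split=> l /= [h1 h2]; split=> // i; [move=> _|]; exact: h1.
- apply: (@rV_compact (R : ptopologicalType) k (fun=> `[0, 1]%classic)) => _.
  exact: segment_compact.
- move=> l [l0 l1] i /=; rewrite in_itv /= l0 /= -l1 (bigD1 i) //= lerDl.
  by apply: sumr_ge0 => j _.
Qed.

Lemma dotv_hull_ge c d k (p : k.-tuple 'rV[R]_n) :
  (forall i, d <= dotv c (tnth p i)) -> hull p `<=` halfspace c d.
Proof.
move=> hp x [l [l0 l1 ->]]; rewrite /halfspace /= dotv_sumr -[d]mul1r -l1 mulr_suml.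
by apply: ler_sum => i _; rewrite dotvZr ler_wpM2l.
Qed.

Lemma hull_isometry g k (p : k.-tuple 'rV[R]_n) :
  euclidean_isometry g -> g @` hull p = hull (map_tuple g p).
Proof.
move=> hg; have E (l : 'I_k -> R) : \sum_i l i = 1 ->
    g (\sum_i l i *: tnth p i) = \sum_i l i *: tnth (map_tuple g p) i.
  by move=> l1; rewrite isometry_sum //; apply: eq_bigr => i _; rewrite tnth_map.
apply/seteqP; split=> [_ [x [l [l0 l1 ->]] <-]|x [l [l0 l1 ->]]].
  by exists l; split=> //; rewrite E.
by exists (\sum_i l i *: tnth p i); [exists l|rewrite E].
Qed.

(** This form treats all vertices alike, whereas the definition singles out vertex 0; cutting an
    edge may replace any vertex. *)
Lemma affinely_independentP k (p : k.+1.-tuple 'rV[R]_n) :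
  reflect (forall l : 'I_k.+1 -> R, \sum_i l i = 0 ->
             \sum_i l i *: tnth p i = 0 -> forall i, l i = 0)
          (affinely_independent p).
Proof.
rewrite /affinely_independent; set M := (X in row_free X).
have E (l : 'I_k.+1 -> R) : \sum_i l i = 0 ->
    (\row_i l (lift ord0 i)) *m M = \sum_i l i *: tnth p i.
  rewrite big_ord_recl => /eqP; rewrite addr_eq0 => /eqP l0.
  rewrite mulmx_sum_row [RHS]big_ord_recl l0 scaleNr scaler_suml.
  rewrite -sumrN -big_split; apply: eq_bigr => i _ /=.
  by rewrite mxE rowK scalerBr addrC.
apply: (iffP idP) => [fM l l0 lp|h].
  have ll i : l (lift ord0 i) = 0.
    have /rowP/(_ i) : \row_i l (lift ord0 i) = 0.
      by apply: (row_free_inj fM); rewrite E // lp mul0mx.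
    by rewrite !mxE.
  move=> i; case: (unliftP ord0 i) => [j ->|->] //.
  by move: l0; rewrite big_ord_recl big1 // addr0.
rewrite -kermx_eq0; apply/eqP/row_matrixP => i.
rewrite row0; set u := row i _.
have uM : u *m M = 0 by apply/sub_kermxP; exact: row_sub.
(* A kernel vector of the difference matrix is extended to vertex 0 by the coefficient that makes
   the total zero. *)
pose l j := if unlift ord0 j is Some j' then u 0 j' else - \sum_j' u 0 j'.
have l0 : \sum_j l j = 0.
  rewrite big_ord_recl /l unlift_none.
  by under [X in _ + X]eq_bigr do rewrite liftK; rewrite addNr.
have lu : \row_j l (lift ord0 j) = u.
  by apply/rowP => j; rewrite mxE /l liftK.
apply/rowP => j; have := h l l0; rewrite -E // lu => /(_ uM (lift ord0 j)).
by rewrite /l liftK => ->; rewrite mxE.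
Qed.

Lemma affinely_independent_isometry g k (p : k.+1.-tuple 'rV[R]_n) :
  euclidean_isometry g ->
  affinely_independent p -> affinely_independent (map_tuple g p).
Proof.
move=> /isometry_mx[M MM gE] /affinely_independentP hp.
apply/affinely_independentP => l l0 lp; apply: hp => //.
suff e : (\sum_i l i *: tnth p i) *m M = 0 by rewrite -[LHS]mulmx1 -MM mulmxA e mul0mx.
move: lp; under eq_bigr do rewrite tnth_map gE scalerDr scalemxAl.
by rewrite big_split /= -scaler_suml l0 scale0r addr0 -mulmx_suml.
Qed.

Lemma polytope_isometry g P :
  euclidean_isometry g -> polytope P -> polytope (g @` P).
Proof.
move=> hg [s [s0 /allP sa ->]]; exists (map (map_tuple g) s); split.
- by case: s s0 {sa}.
- rewrite all_map; apply/allP => p ps; apply: affinely_independent_isometry => //.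
  exact: sa.
- rewrite image_bigcup; apply/seteqP; split=> x [p ps].
    by rewrite hull_isometry // => hx; exists (map_tuple g p) => //=; exact: map_f.
  by case/mapP: ps => q qs -> hx; exists q => //; rewrite hull_isometry.
Qed.

Lemma polytope_bigcup k (Ps : 'I_k.+1 -> set 'rV[R]_n) :
  (forall i, polytope (Ps i)) -> polytope (\bigcup_i Ps i).
Proof.
move=> /choice[s hs]; exists (flatten [seq s i | i <- enum 'I_k.+1]); split.
- have [] := hs ord0; case E : (s ord0) => [//|p s'] _ _ _.
  have : p \in flatten [seq s i | i <- enum 'I_k.+1].
    by apply/flatten_mapP; exists ord0; rewrite ?mem_enum // E mem_head.
  by apply: contraTneq => ->.
- apply/allP => p /flatten_mapP[i _ ps]; have [_ /allP + _] := hs i; exact.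
- apply/seteqP; split=> x.
    move=> [i _]; have [_ _ ->] := hs i => -[p ps px]; exists p => //=.
    by apply/flatten_mapP; exists i => //; rewrite mem_enum.
  move=> [p /= /flatten_mapP[i _ ps] px]; exists i => //.
  by have [_ _ ->] := hs i; exists p.
Qed.

(** * Cutting simplices along a hyperplane *)

Definition replace k (p : k.-tuple 'rV[R]_n) (i : 'I_k) v : k.-tuple 'rV[R]_n :=
  [tuple if j == i then v else tnth p j | j < k].

Section Edge.
Variables (k : nat) (p : k.+1.-tuple 'rV[R]_n) (i j : 'I_k.+1) (t : R).
Hypotheses (ij : i != j) (t0 : 0 < t) (t1 : t < 1).

Let q := replace p i (tnth p i + t *: (tnth p j - tnth p i)).
(** Moves weight [s] from vertex [i] to vertex [j], keeping the total. A combination of the vertices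
    of [q] is one of the vertices of [p] after the transfer of [l i * t]. *)
Let transfer (s : R) (l : 'I_k.+1 -> R) h := l h + s * ((h == j)%:R - (h == i)%:R).

Let sum_transfer s l : \sum_h transfer s l h = \sum_h l h.
Proof.
rewrite big_split -mulr_sumr sumrB /=.
have d1 h : \sum_(a < k.+1) (a == h)%:R = 1 :> R.
  by rewrite (bigD1 h) //= eqxx big1 ?addr0 // => a /negPf ->.
by rewrite !d1 subrr mulr0 addr0.
Qed.

Let sum_replace l :
  \sum_h l h *: tnth q h = \sum_h transfer (l i * t) l h *: tnth p h.
Proof.
have d1 h : \sum_(a < k.+1) (a == h)%:R *: tnth p a = tnth p h.
  by rewrite (bigD1 h) //= eqxx scale1r big1 ?addr0 // => a /negPf ->; rewrite scale0r.
under [RHS]eq_bigr do rewrite scalerDl -scalerA scalerBl.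
rewrite big_split -scaler_sumr sumrB /= !d1 (bigD1 i) //= [X in _ = X + _](bigD1 i) //=.
rewrite tnth_mktuple eqxx scalerDr scalerA [RHS]addrAC; congr (_ + _).
by apply: eq_bigr => h /negPf hi; rewrite tnth_mktuple hi.
Qed.

(** The coefficient at [i] becomes [l i * (1 - t)]. It vanishes only if [l i = 0], and then nothing
    is transferred. *)
Lemma affinely_independent_replace :
  affinely_independent p -> affinely_independent q.
Proof.
move=> /affinely_independentP hp; apply/affinely_independentP => l l0.
rewrite sum_replace => /hp; rewrite sum_transfer => /(_ l0) h.
have li : l i = 0.
  have : l i * (1 - t) = 0 by rewrite -[RHS](h i) /transfer eqxx (negPf ij) /=; ring.
  by move/eqP; rewrite mulf_eq0 subr_eq0 [1 == t]gt_eqF // orbF => /eqP.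
by move=> a; have := h a; rewrite /transfer li mul0r mul0r addr0.
Qed.

Lemma hull_replace : hull q `<=` hull p.
Proof.
move=> x [l [l0 l1 ->]]; exists (transfer (l i * t) l); split.
- move=> a; have lj := l0 j; have li := l0 i; rewrite /transfer.
  have [->|aj] := eqVneq a j.
    by rewrite eq_sym (negPf ij) subr0 mulr1 addr_ge0 // mulr_ge0 // ltW.
  have [->|ai] := eqVneq a i; last by rewrite subrr mulr0 addr0.
  by rewrite sub0r mulrN1 -[X in X - _]mulr1 -mulrBr mulr_ge0 // subr_ge0 ltW.
- by rewrite sum_transfer.
- exact: sum_replace.
Qed.

(** Undoing the transfer, the weight at the new vertex must be [r = l i / (1 - t)] and the weight at
    [j] drops to [l j - r * t]; the last hypothesis says that this is nonnegative. *)
Lemma mem_hull_replace l : (forall h, 0 <= l h) -> \sum_h l h = 1 ->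
  l i * t <= l j * (1 - t) -> hull q (\sum_h l h *: tnth p h).
Proof.
move=> l0 l1 hl; pose r := l i / (1 - t).
have t1' : 1 - t != 0 by rewrite subr_eq0 gt_eqF.
have r0 : 0 <= r by rewrite divr_ge0 // subr_ge0 ltW.
have rt : r * (1 - t) = l i by rewrite /r divfK.
have mi : transfer (- (r * t)) l i = r.
  by rewrite /transfer eqxx (negPf ij) sub0r mulrN1 opprK -rt; ring.
exists (transfer (- (r * t)) l); split.
- move=> a; rewrite /transfer.
  have [->|aj] := eqVneq a j.
    rewrite eq_sym (negPf ij) subr0 mulr1 subr_ge0.
    have t1p : 0 < 1 - t by rewrite subr_gt0.
    by rewrite -(ler_pM2r t1p) mulrAC rt.
  have [->|ai] := eqVneq a i; last by rewrite subrr mulr0 addr0.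
  by have := mi; rewrite /transfer eqxx (negPf ij) => ->.
- by rewrite sum_transfer.
- rewrite sum_replace mi; apply: eq_bigr => h _; congr (_ *: _).
  by rewrite /transfer; ring.
Qed.

End Edge.

(** Whichever of [l i * t] and [l j * (1 - t)] is smaller decides the half. The second half is the
    first with [i] and [j] exchanged and [1 - t] for [t]. *)
Lemma hull_split k (p : k.+1.-tuple 'rV[R]_n) i j t :
  i != j -> 0 < t < 1 ->
  let m := tnth p i + t *: (tnth p j - tnth p i) in
  hull p = hull (replace p i m) `|` hull (replace p j m).
Proof.
move=> ij /andP[t0 t1] m.
have mE : m = tnth p j + (1 - t) *: (tnth p i - tnth p j).
  by apply/rowP => a; rewrite !mxE; ring.
have ji : j != i by rewrite eq_sym.
have t0' : 0 < 1 - t by lra.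
have t1' : 1 - t < 1 by lra.
apply/seteqP; split=> [x [l [l0 l1 ->]]|x].
  have [h|h] := leP (l i * t) (l j * (1 - t)); [left|right].
    exact: mem_hull_replace.
  by rewrite mE; apply: mem_hull_replace => //; rewrite subKr ltW.
by case; [|rewrite mE]; apply: hull_replace.
Qed.

Definition uncrossed c d k (p : k.+1.-tuple 'rV[R]_n) :=
  exists s : seq (k.+1.-tuple 'rV[R]_n),
    [/\ all (@affinely_independent R n k) s,
        hull p = \bigcup_(q in [set` s]) hull q &
        forall q, q \in s -> (forall i, d <= dotv c (tnth q i)) \/
                             (forall i, dotv c (tnth q i) <= d)].

(* Repeatedly cut an edge that crosses the hyperplane at the crossing point:
   the number of vertices off the hyperplane decreases. *)
Lemma hull_refine c d k (p : k.+1.-tuple 'rV[R]_n) : affinely_independent p ->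
  uncrossed c d p.
Proof.
have [N] := ubnP #|[pred i | dotv c (tnth p i) != d]|.
elim: N p => // N IH p ltN hp.
have single : (forall i, d <= dotv c (tnth p i)) \/
              (forall i, dotv c (tnth p i) <= d) -> uncrossed c d p.
  move=> h; exists [:: p]; split; rewrite /= ?hp //.
    apply/seteqP; split=> [x px|x [q /=]]; first by exists p; rewrite /= ?mem_head.
    by rewrite inE => /eqP ->.
  by move=> q; rewrite inE => /eqP ->.
have [/forallP h|] := boolP [forall i, d <= dotv c (tnth p i)].
  by apply: single; left.
rewrite negb_forall => /existsP[i]; rewrite -ltNge => pi.
have [/forallP h|] := boolP [forall i, dotv c (tnth p i) <= d].
  by apply: single; right.
rewrite negb_forall => /existsP[j]; rewrite -ltNge => pj.
have ij : i != j by apply: contraTneq pi => ->; rewrite -leNgt ltW.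
pose t := (d - dotv c (tnth p i)) / (dotv c (tnth p j) - dotv c (tnth p i)).
have den : 0 < dotv c (tnth p j) - dotv c (tnth p i) by lra.
have t01 : 0 < t < 1.
  by apply/andP; split; [rewrite divr_gt0 // subr_gt0|rewrite ltr_pdivrMr //; lra].
pose m := tnth p i + t *: (tnth p j - tnth p i).
have cm : dotv c m = d.
  rewrite /m dotvDr dotvZr dotvDr dotvNr /t divfK ?gt_eqF //; lra.
have card h : dotv c (tnth p h) != d ->
    (#|[pred a | dotv c (tnth (replace p h m) a) != d]| < N)%N.
  move=> ph; rewrite -ltnS; apply: leq_trans ltN; rewrite ltnS.
  apply: proper_card; apply/properP; split; last first.
    by exists h; rewrite !inE // tnth_mktuple eqxx cm eqxx.
  apply/fintype.subsetP => a; rewrite !inE tnth_mktuple.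
  by have [_|//] := eqVneq a h; rewrite cm eqxx.
have /andP[t0 t1] := t01.
have [s1 [a1 e1 f1]] : uncrossed c d (replace p i m).
  by apply: IH; [apply: card; rewrite lt_eqF|exact: affinely_independent_replace].
have [s2 [a2 e2 f2]] : uncrossed c d (replace p j m).
  apply: IH; first by apply: card; rewrite gt_eqF.
  rewrite /m (_ : _ + _ = tnth p j + (1 - t) *: (tnth p i - tnth p j)).
    by apply: affinely_independent_replace => //; [rewrite eq_sym|lra].
  by apply/rowP => a; rewrite !mxE; ring.
exists (s1 ++ s2); split.
- by rewrite all_cat a1.
- rewrite (hull_split _ ij t01) -/m e1 e2 -bigcup_setU.
  by congr (bigcup _ _); apply/seteqP; split=> q; rewrite /= mem_cat => /orP.
- by move=> q; rewrite mem_cat => /orP[/f1|/f2].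
Qed.

Lemma nbhs_segment (B : set 'rV[R]_n) (x v : 'rV[R]_n) :
  nbhs x B -> exists2 t, 0 < t <= 1 & B (x + t *: v).
Proof.
(* The summand 1 keeps the denominator positive when [v = 0], and the factor 1/2 makes the final
   inequality strict. *)
move=> /nbhs_ballP[e /= e0 eB]; exists (Num.min 1 (e / (1 + `|v|) / 2)).
  have v0 : 0 < 1 + `|v| by rewrite ltr_pwDl.
  by rewrite lt_min ltr01 !divr_gt0 //= ge_min lexx.
apply: eB; rewrite -ball_normE /= opprD addrA subrr sub0r normrN normrZ.
have v0 : 0 < 1 + `|v| by rewrite ltr_pwDl.
set t := Num.min _ _; have t0 : 0 < t by rewrite lt_min ltr01 !divr_gt0.
have te : t * (1 + `|v|) <= e / 2.
  by rewrite -ler_pdivlMr // mulrAC ge_min lexx orbT.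
by rewrite gtr0_norm //; nra.
Qed.

(* The simplices of a refinement that lie on the wrong side may still meet the
   bounding hyperplane, but each such point is a limit of points of the open
   halfspace, which lie in the closed union of the other simplices. *)
Lemma polytope_halfspace c d P : polytope P -> convex P ->
  (exists2 y, P y & d < dotv c y) -> polytope (P `&` halfspace c d).
Proof.
move=> [s [s0 /allP sa PE]] cP [y Py dy].
(* [choice] asks for a refinement of every tuple, so independence is assumed inside the existential
   and degenerate tuples receive the empty list. *)
have /choice[r hr] : forall p : n.+1.-tuple 'rV[R]_n, exists s,
    affinely_independent p ->
    [/\ all (@affinely_independent R n n) s,
        hull p = \bigcup_(q in [set` s]) hull q &
        forall q, q \in s -> (forall i, d <= dotv c (tnth q i)) \/
                             (forall i, dotv c (tnth q i) <= d)].
  move=> p; have [/(hull_refine c d)[s' h]|_] := boolP (affinely_independent p).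
    by exists s' => _.
  by exists [::].
pose T := [seq q <- flatten [seq r p | p <- s] |
            [forall i, d <= dotv c (tnth q i)]].
have TP q : q \in T -> hull q `<=` P.
  rewrite mem_filter => /andP[_ /flatten_mapP[p ps qr]] x qx.
  have [_ pE _] := hr p (sa _ ps).
  by rewrite PE; exists p => //; rewrite pE; exists q.
have open_T x : P x -> d < dotv c x -> (\bigcup_(q in [set` T]) hull q) x.
  rewrite {1}PE => -[p /= ps]; have [_ -> sgn] := hr p (sa _ ps).
  move=> [q /= qr qx] dx; exists q => //=; rewrite mem_filter.
  apply/andP; split; last by apply/flatten_mapP; exists p.
  have [/forallP//|qd] := sgn q qr.
  have : halfspace (- c) (- d) x.
    by apply: (dotv_hull_ge _ qx) => i; rewrite dotvNl lerN2.
  by rewrite /halfspace /= dotvNl lerN2 leNgt dx.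
exists T; split.
(* The point [y] strictly inside the halfspace ensures that at least one simplex survives. *)
- have [q /= qT _] := open_T y Py dy.
  by apply: contraTneq qT => ->.
- apply/allP => q; rewrite mem_filter => /andP[_ /flatten_mapP[p ps qr]].
  by have [/allP + _ _] := hr p (sa _ ps); exact.
apply/seteqP; split=> [x [Px dx]|x [q /= qT qx]]; last first.
  split; first exact: TP qx.
  by move: qT; rewrite mem_filter => /andP[/forallP h _]; exact: dotv_hull_ge qx.
have cT : closed (\bigcup_(q in [set` T]) hull q).
  by apply: closed_bigcup => [|q _]; [exact: finite_seq|exact: hull_closed].
apply: cT => B /(nbhs_segment (y - x))[t /andP[t0 t1] Bt].
exists (x + t *: (y - x)); split=> //; apply: open_T.
  by apply: cP => //; rewrite ltW.
move: dx; rewrite /halfspace /= dotvDr dotvZr dotvDr dotvNr => dx.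
by nra.
Qed.

(** * Disjoint interiors *)

(** From a common interior point, a small step along [c] stays in [Q] but makes [dotv c] exceed
    [d]. *)
Lemma separated_interior c d P Q : c != 0 ->
  P `<=` halfspace c d -> Q `<=` halfspace (- c) (- d) -> P° `&` Q° = set0.
Proof.
move=> c0 hP hQ; rewrite -subset0 => x [Px Qx].
have [t /andP[t0 _] Qt] := nbhs_segment c Qx.
have := hP _ (interior_subset Px); have := hQ _ Qt.
rewrite /halfspace /= dotvNl lerN2 dotvDr dotvZr.
have : 0 < dotv c c by rewrite lt0r dotvv_ge0 dotvv_eq0 c0.
by move=> cc h1 h2; nra.
Qed.

(** By injectivity [P] is the preimage of its image, and preimages of neighbourhoods under the
    continuous [g] are neighbourhoods. *)
Lemma interior_isometry g P :
  euclidean_isometry g -> (g @` P)° `<=` g @` P°.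
Proof.
move=> hg y hy; have [x Px xy] := interior_subset hy.
exists x => //; have -> : P = g @^-1` (g @` P).
  apply/seteqP; split=> z; first exact: imageP.
  by move=> [z' Pz' /(isometry_injective hg) <-].
by apply: isometry_continuous => //; rewrite xy.
Qed.

Lemma disjoint_interior_isometry g P Q : euclidean_isometry g ->
  P° `&` Q° = set0 -> (g @` P)° `&` (g @` Q)° = set0.
Proof.
move=> hg PQ; rewrite -subset0 => y [].
move=> /(interior_isometry hg)[x Px <-] /(interior_isometry hg)[x' Qx' e].
suff : set0 x by [].
by rewrite -PQ; split=> //; rewrite -(isometry_injective hg e).
Qed.

Lemma disjoint_interiorS P P' Q Q' : P' `<=` P -> Q' `<=` Q ->
  P° `&` Q° = set0 -> P'° `&` Q'° = set0.
Proof.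
move=> hP hQ; rewrite -!subset0; apply: subset_trans.
by apply: setISS; exact: interiorS.
Qed.

Lemma tilingP k P (Ps : 'I_k -> set 'rV[R]_n) :
  (forall i j : 'I_k, (i < j)%N -> (Ps i)° `&` (Ps j)° = set0) ->
  \bigcup_i Ps i = P -> tiling P Ps.
Proof.
move=> h; split=> //; apply/trivIsetP => i j _ _ /eqP ij.
have [/h //|/h|/val_inj//] := ltngtP i j.
by rewrite setIC.
Qed.

Lemma tiling_isometry g k P (Ps : 'I_k -> set 'rV[R]_n) :
  euclidean_isometry g -> tiling P Ps ->
  tiling (g @` P) (fun i => g @` Ps i).
Proof.
move=> hg [/trivIsetP h <-]; split; last by rewrite image_bigcup.
by apply/trivIsetP => i j _ _ ij; apply: disjoint_interior_isometry => //; exact: h.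
Qed.

End Hull.

(** A single point strictly inside all the halfspaces serves as the witness at each successive
    cut. *)
Lemma polytope_halfspaces (R : realType) n (P : set 'rV[R]_n)
    (s : seq ('rV[R]_n * R)) : polytope P -> convex P ->
  (exists2 y, P y & all (fun h => h.2 < dotv h.1 y) s) ->
  polytope (P `&` [set x | all (fun h => h.2 <= dotv h.1 x) s]).
Proof.
elim: s P => [|[c d] s IH] P polP cP [y Py /= ys].
  by rewrite (_ : _ `&` _ = P) //; apply/seteqP; split=> x // [].
have /andP[dy {}ys] := ys.
rewrite (_ : _ `&` _ = P `&` halfspace c d `&`
  [set x | all (fun h => h.2 <= dotv h.1 x) s]); last first.
  apply/seteqP; split=> x /=; first by move=> [Px /andP[]].
  by move=> [[Px dx] xs]; split=> //; apply/andP.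
apply: IH; last by exists y => //; split=> //; exact: ltW.
  by apply: polytope_halfspace => //; exists y.
by apply: convexI => //; exact: convex_halfspace.
Qed.

(** * The six pieces *)

(** Turns membership in a moved piece into inequalities on the coordinates of the inverse motion. *)
Lemma image_cancel (T U : Type) (f : T -> U) (g : U -> T) (A : set T) :
  cancel f g -> cancel g f -> f @` A = g @^-1` A.
Proof.
move=> fg gf; apply/seteqP; split=> [_ [x Ax <-]|y Ay] /=; first by rewrite fg.
by exists (g y).
Qed.

(** * Coordinates, the three motions and the simplex tau *)

Section Coordinates.
Variable R : realType.
Implicit Types (w x y z : R) (p q u v : 'rV[R]_4).

Lemma pt4E w x y z :
  (wc (pt4 w x y z) = w) * (xc (pt4 w x y z) = x) *
  (yc (pt4 w x y z) = y) * (zc (pt4 w x y z) = z).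
Proof. by rewrite /wc /xc /yc /zc !mxE. Qed.

Lemma ord4P (Q : 'I_4 -> Prop) :
  Q (@Ordinal 4 0 isT) -> Q (@Ordinal 4 1 isT) ->
  Q (@Ordinal 4 2 isT) -> Q (@Ordinal 4 3 isT) -> forall i, Q i.
Proof.
move=> h0 h1 h2 h3 [[|[|[|[|//]]]] hi].
- by rewrite (_ : Ordinal hi = @Ordinal 4 0 isT) //; exact/val_inj.
- by rewrite (_ : Ordinal hi = @Ordinal 4 1 isT) //; exact/val_inj.
- by rewrite (_ : Ordinal hi = @Ordinal 4 2 isT) //; exact/val_inj.
- by rewrite (_ : Ordinal hi = @Ordinal 4 3 isT) //; exact/val_inj.
Qed.

Lemma pt4_inj u v :
  wc u = wc v -> xc u = xc v -> yc u = yc v -> zc u = zc v -> u = v.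
Proof. by move=> hw hx hy hz; apply/rowP; apply: ord4P. Qed.

Lemma coordB u v : (wc (u - v) = wc u - wc v) * (xc (u - v) = xc u - xc v) *
  (yc (u - v) = yc u - yc v) * (zc (u - v) = zc u - zc v).
Proof. by rewrite /wc /xc /yc /zc !mxE. Qed.

Lemma dotv4 u v :
  dotv u v = wc u * wc v + xc u * xc v + yc u * yc v + zc u * zc v.
Proof.
rewrite /dotv !big_ord_recl big_ord0 addr0 !addrA /wc /xc /yc /zc.
by do !congr (_ + _); congr (u _ _ * v _ _); exact/val_inj.
Qed.

Lemma alphaK : involutive (alpha R).
Proof. by move=> p; apply: pt4_inj; rewrite /alpha !pt4E; ring. Qed.

Lemma betaK : involutive (beta R).
Proof. by move=> p; apply: pt4_inj; rewrite /beta !pt4E; ring. Qed.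

Definition gamma_inv p := pt4 (1 + zc p) (wc p) (xc p) (yc p).

Lemma gammaK : cancel (gamma R) gamma_inv.
Proof. by move=> p; apply: pt4_inj; rewrite /gamma_inv /gamma !pt4E //; ring. Qed.

Lemma gamma_invK : cancel gamma_inv (gamma R).
Proof. by move=> p; apply: pt4_inj; rewrite /gamma_inv /gamma !pt4E //; ring. Qed.

Lemma isometry_alpha : euclidean_isometry (alpha R).
Proof. by apply/isometryP => u v; rewrite !dotv4 !coordB /alpha !pt4E; ring. Qed.

Lemma isometry_beta : euclidean_isometry (beta R).
Proof. by apply/isometryP => u v; rewrite !dotv4 !coordB /beta !pt4E; ring. Qed.

Lemma isometry_gamma : euclidean_isometry (gamma R).
Proof. by apply/isometryP => u v; rewrite !dotv4 !coordB /gamma !pt4E; ring. Qed.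

Lemma isometry_to_tau : euclidean_isometry (to_tau R).
Proof. by move=> u v; rewrite /Defs.edist /to_tau opprB addrA subrK. Qed.

Lemma alpha_image (A : set 'rV[R]_4) : alpha R @` A = alpha R @^-1` A.
Proof. exact: image_cancel alphaK alphaK. Qed.

Lemma beta_image (A : set 'rV[R]_4) : beta R @` A = beta R @^-1` A.
Proof. exact: image_cancel betaK betaK. Qed.

Lemma gamma_image (A : set 'rV[R]_4) : gamma R @` A = gamma_inv @^-1` A.
Proof. exact: image_cancel gammaK gamma_invK. Qed.

(** Indexing the terms by natural numbers leaves closed expressions that [lra] can match. *)
Lemma big_ord5 (V : nmodType) (F : 'I_5 -> V) (f : nat -> V) :
  (forall i, F i = f i) ->
  \sum_i F i = f 0%N + f 1%N + f 2%N + f 3%N + f 4%N.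
Proof.
move=> Ff; rewrite (eq_bigr (fun i : 'I_5 => f i)) // -(big_mkord xpredT f).
by rewrite unlock /= addr0 !addrA.
Qed.

(** Each vertex has coordinates 1/2 followed by coordinates -1/2, so every coordinate is a tail sum
    of weights minus half the total. The total [s] is left free: it is 1 for the hull and 0 for
    affine independence. *)
Lemma tau_sum (l : nat -> R) : let s := l 0%N + l 1%N + l 2%N + l 3%N + l 4%N in
  \sum_(i < 5) l i *: tnth [tuple ptA R; ptB R; ptC R; ptD R; ptE R] i =
  pt4 (l 1%N + l 2%N + l 3%N + l 4%N - 2^-1 * s) (l 2%N + l 3%N + l 4%N - 2^-1 * s)
      (l 3%N + l 4%N - 2^-1 * s) (l 4%N - 2^-1 * s).
Proof.
rewrite (@big_ord5 _ _ (fun i => l i *: nth 0 [:: ptA R; ptB R; ptC R; ptD R; ptE R] i)).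
  by apply: pt4_inj; rewrite !pt4E /wc /xc /yc /zc !mxE /= !(tnth_nth 0) /=; field.
by move=> i; rewrite (tnth_nth 0).
Qed.

Lemma tauP p : tau R p <->
  [/\ - 2^-1 <= zc p, zc p <= yc p, yc p <= xc p, xc p <= wc p & wc p <= 2^-1].
Proof.
split.
  move=> [l [l0 l1 ->]]; pose L k := l (inord k).
  have lL i : l i = L i by rewrite /L inord_val.
  under eq_bigr do rewrite lL.
  rewrite tau_sum; move: l1; rewrite (big_ord5 lL) => s1.
  have LP k : 0 <= L k by exact: l0.
  have := LP 0%N; have := LP 1%N; have := LP 2%N; have := LP 3%N; have := LP 4%N.
  by rewrite !pt4E s1 => *; split; lra.
move=> [h0 h1 h2 h3 h4].
(* The barycentric coordinates are the slacks of the five inequalities. *)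
pose L := nth 0 [:: 2^-1 - wc p; wc p - xc p; xc p - yc p; yc p - zc p; zc p + 2^-1].
have L1 : L 0%N + L 1%N + L 2%N + L 3%N + L 4%N = 1 by rewrite /L /=; lra.
exists (fun i => L i); split.
- by move=> [[|[|[|[|[|//]]]]] hi]; rewrite /L /=; lra.
- by rewrite (@big_ord5 _ _ L).
- by rewrite tau_sum L1; apply: pt4_inj; rewrite !pt4E /L /=; lra.
Qed.

Lemma polytope_tau : polytope (tau R).
Proof.
exists [:: [tuple ptA R; ptB R; ptC R; ptD R; ptE R]]; split=> //=; last first.
  apply/seteqP; split=> [x px|x [q /=]]; last by rewrite inE => /eqP ->.
  by exists [tuple ptA R; ptB R; ptC R; ptD R; ptE R]; rewrite /= ?mem_head.
rewrite andbT; apply/affinely_independentP => l; pose L k := l (inord k).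
have lL i : l i = L i by rewrite /L inord_val.
under [in X in _ -> X -> _]eq_bigr do rewrite lL.
rewrite tau_sum (big_ord5 lL) => s0; rewrite s0 mulr0 !subr0 => u0.
have [] : [/\ L 1%N + L 2%N + L 3%N + L 4%N = 0, L 2%N + L 3%N + L 4%N = 0,
    L 3%N + L 4%N = 0 & L 4%N = 0].
  split; [have := congr1 (@wc R) u0|have := congr1 (@xc R) u0|
          have := congr1 (@yc R) u0|have := congr1 (@zc R) u0];
    by rewrite pt4E => ->; rewrite [LHS]mxE.
move=> h1 h2 h3 h4 i; rewrite lL.
by case: i => [[|[|[|[|[|//]]]]] hi] /=; lra.
Qed.

End Coordinates.

Lemma bigcup_ord_recl T k (F : 'I_k.+1 -> set T) :
  \bigcup_i F i = F ord0 `|` \bigcup_i F (lift ord0 i).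
Proof.
apply/seteqP; split=> [x [i _]|x [Fx|[i _ Fx]]]; last by exists (lift ord0 i).
  by case: (unliftP ord0 i) => [j ->|->]; [right; exists j|left].
by exists ord0.
Qed.

Lemma bigcup_ord0 T (F : 'I_0 -> set T) : \bigcup_i F i = set0.
Proof. by rewrite -subset0 => x [[]]. Qed.

(** * Inequalities, separating hyperplanes and polytopality of the pieces *)

Section Pieces.
Variable R : realType.
Implicit Types (p q u v : 'rV[R]_4) (A : set 'rV[R]_4).

Lemma tau4P p : tau4 R p <->
  [/\ [/\ zc p <= yc p, yc p <= xc p & xc p <= wc p],
      [/\ - 2^-1 <= yc p, xc p <= 2^-1 & wc p <= 1 + zc p],
      - 2^-1 <= wc p + yc p + zc p & wc p + xc p + zc p <= 2^-1].
Proof.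
rewrite /tau4 alpha_image beta_image /setU /preimage /tau1 /tau2 /tau3 /setI /=.
rewrite !tauP /alpha /beta !pt4E; split.
  by case=> [[] |] [[? ? ? ? ?]]; [|case|] => *; split; solve [split; lra|lra].
move=> [[? ? ?] [? ? ?] ? ?].
(* [alpha] reflects z in z = -1/2 and [beta] reflects w in w = 1/2. These two walls of [tau]
   separate the moved pieces from [tau2]. *)
have [?|?] := leP (zc p) (- 2^-1).
  by left; left; split; [split; lra|lra].
have [?|?] := leP 2^-1 (wc p).
  by right; split; [split; lra|lra].
by left; right; split; split; lra.
Qed.

Lemma tau7P p : tau7 R p <->
  [/\ zc p <= yc p, yc p <= xc p, xc p <= wc p, wc p <= 1 + zc p &
      -1 <= wc p + xc p + yc p + zc p <= 0].
Proof.
rewrite /tau7 gamma_image /setU /preimage /tau5 /tau6 /setI /=.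
rewrite !tau4P /gamma_inv !pt4E; split.
  by case=> -[[[? ? ?] [? ? ?] ? ?] ?]; split; solve [apply/andP; split; lra|lra].
move=> [? ? ? ? /andP[? ?]].
(* [gamma] carries the bound w + x + z <= 1/2 of [tau4] to w + y + z <= -1/2, which abuts the bound
   w + y + z >= -1/2 of [tau5]. *)
have [?|?] := leP (- 2^-1) (wc p + yc p + zc p); [left|right].
  by split; [split; solve [split; lra|lra]|lra].
by split; [split; solve [split; lra|lra]|lra].
Qed.

(** The coefficients [a], [b], [c], [e] form a normal pointing towards [A], and [d] is the level of
    the hyperplane. *)
Lemma separated4 (a b c e d : R) A B : 0 < a * a + b * b + c * c + e * e ->
  (forall p, A p -> d <= a * wc p + b * xc p + c * yc p + e * zc p) ->
  (forall p, B p -> a * wc p + b * xc p + c * yc p + e * zc p <= d) ->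
  A° `&` B° = set0.
Proof.
move=> abce hA hB; apply: (@separated_interior _ _ (pt4 a b c e) d).
- by rewrite -dotvv_eq0 gt_eqF // dotv4 !pt4E.
- by move=> p Ap; rewrite /halfspace /= dotv4 !pt4E; exact: hA.
- by move=> p Bp; rewrite /halfspace /= dotvNl lerN2 dotv4 !pt4E; exact: hB.
Qed.

Lemma disjoint_tau12 : (tau1 R)° `&` (tau2 R)° = set0.
Proof.
apply: (@separated4 (-1) 0 (-1) (-1) 2^-1); first lra.
- by move=> p [_ /= h]; lra.
- by move=> p [_ /= [h _]]; lra.
Qed.

Lemma disjoint_tau23 : (tau2 R)° `&` (tau3 R)° = set0.
Proof.
apply: (@separated4 (-1) (-1) 0 (-1) (- 2^-1)); first lra.
- by move=> p [_ /= [_ h]]; lra.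
- by move=> p [_ /= h]; lra.
Qed.

(** The first cut also separates the outer pieces: on [tau3], x <= 1/2 gives w + z >= 0, and y >=
    -1/2. *)
Lemma disjoint_tau13 : (tau1 R)° `&` (tau3 R)° = set0.
Proof.
apply: (@separated4 (-1) 0 (-1) (-1) 2^-1); first lra.
- by move=> p [_ /= h]; lra.
- by move=> p [/tauP[? ? ? ? ?] /= h]; lra.
Qed.

Lemma disjoint_alpha_tau2 : (alpha R @` tau1 R)° `&` (tau2 R)° = set0.
Proof.
apply: (@separated4 0 0 0 (-1) 2^-1); first lra.
- by move=> p; rewrite alpha_image => -[/tauP]; rewrite /alpha !pt4E => -[*]; lra.
- by move=> p [/tauP[? ? ? ? ?] _]; lra.
Qed.

(** The wall w = 1/2 works here too, since the first coordinate on the image of [tau1] is some -y <=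
    1/2. *)
Lemma disjoint_alpha_beta :
  (alpha R @` tau1 R)° `&` (beta R @` tau3 R)° = set0.
Proof.
apply: (@separated4 (-1) 0 0 0 (- 2^-1)); first lra.
- move=> p; rewrite alpha_image => -[/tauP]; rewrite /alpha !pt4E => -[*]; lra.
- by move=> p; rewrite beta_image => -[/tauP]; rewrite /beta !pt4E => -[*]; lra.
Qed.

Lemma disjoint_tau2_beta : (tau2 R)° `&` (beta R @` tau3 R)° = set0.
Proof.
apply: (@separated4 (-1) 0 0 0 (- 2^-1)); first lra.
- by move=> p [/tauP[? ? ? ? ?] _]; lra.
- by move=> p; rewrite beta_image => -[/tauP]; rewrite /beta !pt4E => -[*]; lra.
Qed.

Lemma disjoint_tau56 : (tau5 R)° `&` (tau6 R)° = set0.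
Proof.
apply: (@separated4 (-1) (-1) (-1) (-1) 0); first lra.
- by move=> p [_ /= h]; lra.
- by move=> p [_ /= h]; lra.
Qed.

Lemma disjoint_tau5_gamma : (tau5 R)° `&` (gamma R @` tau6 R)° = set0.
Proof.
apply: (@separated4 1 0 1 1 (- 2^-1)); first lra.
- by move=> p [/tau4P[? ? ? ?] _]; lra.
- move=> p; rewrite gamma_image => -[/tau4P].
  by rewrite /gamma_inv !pt4E => -[*]; lra.
Qed.

Lemma ptA_tau1 : tau1 R (ptA R).
Proof. by split; [apply/tauP|]; rewrite /ptA /= !pt4E; [split|]; lra. Qed.

Lemma ptE_tau3 : tau3 R (ptE R).
Proof. by split; [apply/tauP|]; rewrite /ptE /= !pt4E; [split|]; lra. Qed.

Lemma tau_cover : tau1 R `|` tau2 R `|` tau3 R = tau R.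
Proof.
apply/seteqP; split=> p; first by case=> [[]|] [].
move=> tp; have [?|?] := leP (wc p + yc p + zc p) (- 2^-1); first by left; left.
have [?|?] := leP 2^-1 (wc p + xc p + zc p); first by right.
by left; right; split=> //=; split; exact: ltW.
Qed.

Lemma tau4_cover : tau5 R `|` tau6 R = tau4 R.
Proof.
apply/seteqP; split=> p; first by case=> -[].
move=> tp; have [?|?] := leP (wc p + xc p + yc p + zc p) 0; first by left.
by right; split=> //; exact: ltW.
Qed.

Lemma to_tau_O4 : to_tau R @` O4 R = tau R.
Proof.
rewrite /O4 hull_isometry; last exact: isometry_to_tau.
rewrite /tau; congr hull; apply: val_inj => /=.
congr [:: _; _; _; _; _]; apply: pt4_inj;
  rewrite /to_tau !coordB !pt4E /wc /xc /yc /zc mxE; lra.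
Qed.

(** A quintuple (a, b, c, e, d) encodes the halfspace a w + b x + c y + e z >= d, so that each piece
    is given by a list of numbers and a point [p] strictly inside these halfspaces. *)
Let polytope_cut A (s : seq (R * R * R * R * R)) (p : 'rV[R]_4) : tau R p ->
  all (fun h => let: (a, b, c, e, d) := h in
    d < a * wc p + b * xc p + c * yc p + e * zc p) s ->
  (forall q, A q <-> tau R q /\ all (fun h => let: (a, b, c, e, d) := h in
    d <= a * wc q + b * xc q + c * yc q + e * zc q) s) -> polytope A.
Proof.
move=> tp ps AP; pose f h := let: (a, b, c, e, d) := h in (pt4 a b c e, d) : 'rV[R]_4 * R.
rewrite (_ : A = tau R `&` [set x | all (fun h => h.2 <= dotv h.1 x) (map f s)]).
  apply: polytope_halfspaces; [exact: polytope_tau|exact: convex_hull|].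
  exists p => //; rewrite all_map; apply: sub_all ps => -[[[[a b] c] e] d] /=.
  by rewrite dotv4 !pt4E.
apply/seteqP; split=> q; rewrite /setI /= AP all_map => -[tq qs]; split=> //;
  by apply: sub_all qs => -[[[[a b] c] e] d] /=; rewrite dotv4 !pt4E.
Qed.

Lemma tau4_alpha p : tau1 R p -> tau4 R (alpha R p).
Proof. by move=> h; left; left; exists p. Qed.

Lemma tau4_beta p : tau3 R p -> tau4 R (beta R p).
Proof. by move=> h; right; exists p. Qed.

Lemma tau4_tau2 p : tau2 R p -> tau4 R p.
Proof. by move=> h; left; right. Qed.

(** Pulled back by [alpha] and [beta], the cut w + x + y + z = 0 becomes w + x + y + z = -1 and w +
    x + y + z = 1 respectively. Each explicit point satisfies the listed inequalities strictly. *)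
Lemma polytope_tau_piece i : polytope (tau_piece R i).
Proof.
rewrite /tau_piece; case: i => [[|[|[|[|[|[|//]]]]]] hi];
  rewrite (tnth_nth set0) /=.
- apply: (@polytope_cut _ [:: (-1, 0, -1, -1, 2^-1); (1, 1, 1, 1, -1)]
    (pt4 10^-1 10^-1 (- (4 / 10)) (- (4 / 10)))).
  + by apply/tauP; rewrite !pt4E; split; lra.
  + by rewrite /= !pt4E !andbT; apply/andP; split; lra.
  move=> q; rewrite /= !andbT; split.
    move=> [[tq /= h] [_]]; rewrite /alpha /= !pt4E => h'.
    by split=> //; apply/andP; split; lra.
  move=> [tq /andP[h h']]; have t1 : tau1 R q by split=> //=; lra.
  split=> //; split; first exact: tau4_alpha.
  by rewrite /alpha /= !pt4E; lra.
- apply: (@polytope_cut _ [:: (-1, 0, -1, -1, 2^-1); (-1, -1, -1, -1, 1)]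
    (pt4 (- (4 / 10)) (- (4 / 10)) (- (4 / 10)) (- (4 / 10)))).
  + by apply/tauP; rewrite !pt4E; split; lra.
  + by rewrite /= !pt4E !andbT; apply/andP; split; lra.
  move=> q; rewrite /= !andbT; split.
    move=> [[tq /= h] [_]]; rewrite /alpha /= !pt4E => h'.
    by split=> //; apply/andP; split; lra.
  move=> [tq /andP[h h']]; have t1 : tau1 R q by split=> //=; lra.
  split=> //; split; first exact: tau4_alpha.
  by rewrite /alpha /= !pt4E; lra.
- apply: (@polytope_cut _ [:: (1, 0, 1, 1, - 2^-1); (-1, -1, 0, -1, - 2^-1);
      (-1, -1, -1, -1, 0)] (pt4 (- 10^-1) (- 10^-1) (- 10^-1) (- 10^-1))).
  + by apply/tauP; rewrite !pt4E; split; lra.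
  + by rewrite /= !pt4E !andbT; apply/and3P; split; lra.
  move=> q; rewrite /= !andbT; split.
    move=> [[tq /= [h h1]] [_ /= h']].
    by split=> //; apply/and3P; split; lra.
  move=> [tq /and3P[h h1 h']]; have t2 : tau2 R q by split=> //=; split; lra.
  by split=> //; split; [exact: tau4_tau2|rewrite /=; lra].
- apply: (@polytope_cut _ [:: (1, 0, 1, 1, - 2^-1); (-1, -1, 0, -1, - 2^-1);
      (1, 1, 1, 1, 0)] (pt4 10^-1 10^-1 10^-1 10^-1)).
  + by apply/tauP; rewrite !pt4E; split; lra.
  + by rewrite /= !pt4E !andbT; apply/and3P; split; lra.
  move=> q; rewrite /= !andbT; split.
    move=> [[tq /= [h h1]] [_ /= h']].
    by split=> //; apply/and3P; split; lra.
  move=> [tq /and3P[h h1 h']]; have t2 : tau2 R q by split=> //=; split; lra.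
  by split=> //; split; [exact: tau4_tau2|rewrite /=; lra].
- apply: (@polytope_cut _ [:: (1, 1, 0, 1, 2^-1); (1, 1, 1, 1, 1)]
    (pt4 (4 / 10) (4 / 10) (4 / 10) (4 / 10))).
  + by apply/tauP; rewrite !pt4E; split; lra.
  + by rewrite /= !pt4E !andbT; apply/andP; split; lra.
  move=> q; rewrite /= !andbT; split.
    move=> [[tq /= h] [_]]; rewrite /beta /= !pt4E => h'.
    by split=> //; apply/andP; split; lra.
  move=> [tq /andP[h h']]; have t3 : tau3 R q by split=> //=; lra.
  split=> //; split; first exact: tau4_beta.
  by rewrite /beta /= !pt4E; lra.
- apply: (@polytope_cut _ [:: (1, 1, 0, 1, 2^-1); (-1, -1, -1, -1, -1)]
    (pt4 (4 / 10) (4 / 10) (- 10^-1) (- 10^-1))).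
  + by apply/tauP; rewrite !pt4E; split; lra.
  + by rewrite /= !pt4E !andbT; apply/andP; split; lra.
  move=> q; rewrite /= !andbT; split.
    move=> [[tq /= h] [_]]; rewrite /beta /= !pt4E => h'.
    by split=> //; apply/andP; split; lra.
  move=> [tq /andP[h h']]; have t3 : tau3 R q by split=> //=; lra.
  split=> //; split; first exact: tau4_beta.
  by rewrite /beta /= !pt4E; lra.
Qed.

End Pieces.

(** * Tilings before and after the motions *)

Lemma image_setI_preimage (T U : Type) (f : T -> U) (A : set T) (B : set U) :
  f @` (A `&` f @^-1` B) = f @` A `&` B.
Proof.
apply/seteqP; split=> [_ [x [Ax Bx] <-]|_ [[x Ax <-] Bx]]; last by exists x.
by split=> //; exists x.
Qed.

Section Tilings.
Variable R : realType.

Lemma final_pieceE i : final_motion R i @` tau_piece R i =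
  tnth [tuple alpha R @` tau1 R `&` tau5 R;
              gamma R @` (alpha R @` tau1 R `&` tau6 R);
              tau2 R `&` tau5 R;
              gamma R @` (tau2 R `&` tau6 R);
              beta R @` tau3 R `&` tau5 R;
              gamma R @` (beta R @` tau3 R `&` tau6 R)] i.
Proof.
rewrite /final_motion /tau_piece.
case: i => [[|[|[|[|[|[|//]]]]]] hi];
  rewrite (tnth_nth id) !(tnth_nth set0) /= ?image_id -?image_setI_preimage //;
  by rewrite image_comp.
Qed.

Lemma tiling_tau : tiling (tau R) (tnth [tuple tau1 R; tau2 R; tau3 R]).
Proof.
apply: tilingP.
  move=> [[|[|[|//]]] hi] [[|[|[|//]]] hj] //= _; rewrite !(tnth_nth set0) /=.
  - exact: disjoint_tau12.
  - exact: disjoint_tau13.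
  - exact: disjoint_tau23.
by rewrite !bigcup_ord_recl bigcup_ord0 setU0 !(tnth_nth set0) /= setUA tau_cover.
Qed.

Lemma tiling_tau4 :
  tiling (tau4 R) (tnth [tuple alpha R @` tau1 R; tau2 R; beta R @` tau3 R]).
Proof.
apply: tilingP.
  move=> [[|[|[|//]]] hi] [[|[|[|//]]] hj] //= _; rewrite !(tnth_nth set0) /=.
  - exact: disjoint_alpha_tau2.
  - exact: disjoint_alpha_beta.
  - exact: disjoint_tau2_beta.
by rewrite !bigcup_ord_recl bigcup_ord0 setU0 !(tnth_nth set0) /= setUA.
Qed.

Lemma tiling_tau4_cut : tiling (tau4 R) (tnth [tuple tau5 R; tau6 R]).
Proof.
apply: tilingP.
  move=> [[|[|//]] hi] [[|[|//]] hj] //= _; rewrite !(tnth_nth set0) /=.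
  exact: disjoint_tau56.
by rewrite !bigcup_ord_recl bigcup_ord0 setU0 !(tnth_nth set0) /= tau4_cover.
Qed.

Lemma tiling_tau7 : tiling (tau7 R) (tnth [tuple tau5 R; gamma R @` tau6 R]).
Proof.
apply: tilingP.
  move=> [[|[|//]] hi] [[|[|//]] hj] //= _; rewrite !(tnth_nth set0) /=.
  exact: disjoint_tau5_gamma.
by rewrite !bigcup_ord_recl bigcup_ord0 setU0 !(tnth_nth set0).
Qed.

(** Pieces from different [tau1], [tau2], [tau3] are separated by the first two cuts, and the two
    pieces inside one of them by the pulled-back third cut. *)
Lemma tiling_tau_piece : tiling (tau R) (tau_piece R).
Proof.
have cut (A X Y : set 'rV[R]_4) : A `<=` X `|` Y -> A `&` X `|` A `&` Y = A.
  by rewrite -setIUr => /setIidl.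
have aD : (alpha R @^-1` tau5 R)° `&` (alpha R @^-1` tau6 R)° = set0.
  rewrite -!alpha_image; apply: disjoint_interior_isometry => //.
    exact: isometry_alpha.
  exact: disjoint_tau56.
have bD : (beta R @^-1` tau5 R)° `&` (beta R @^-1` tau6 R)° = set0.
  rewrite -!beta_image; apply: disjoint_interior_isometry => //.
    exact: isometry_beta.
  exact: disjoint_tau56.
apply: tilingP.
  move=> [[|[|[|[|[|[|//]]]]]] hi] [[|[|[|[|[|[|//]]]]]] hj] //= _;
  rewrite /tau_piece !(tnth_nth set0) /=;
  by [apply: (disjoint_interiorS _ _ (disjoint_tau12 R)); exact: subIsetl
     |apply: (disjoint_interiorS _ _ (disjoint_tau13 R)); exact: subIsetl
     |apply: (disjoint_interiorS _ _ (disjoint_tau23 R)); exact: subIsetl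
     |apply: (disjoint_interiorS _ _ (disjoint_tau56 R)); exact: subIsetr
     |apply: (disjoint_interiorS _ _ aD); exact: subIsetr
     |apply: (disjoint_interiorS _ _ bD); exact: subIsetr].
rewrite /tau_piece !bigcup_ord_recl bigcup_ord0 setU0 !(tnth_nth set0) /= !setUA.
(* Each of the three parts lands in [tau4], the union of [tau5] and [tau6], so its two halves
   reunite. *)
rewrite cut; last by move=> p /tau4_alpha; rewrite -tau4_cover.
rewrite -(setUA (tau1 R)) cut; last by move=> p /tau4_tau2; rewrite -tau4_cover.
rewrite -setUA cut; last by move=> p /tau4_beta; rewrite -tau4_cover.
exact: tau_cover.
Qed.

(** Two pieces on the same side of the third cut are disjoint as in [tau4]; two on opposite sides
    lie in [tau5] and in the image of [tau6] under [gamma]. *)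
Lemma tiling_final_piece :
  tiling (tau7 R) (fun i => final_motion R i @` tau_piece R i).
Proof.
rewrite (funext final_pieceE).
have gD A B : A° `&` B° = set0 -> (gamma R @` (A `&` tau6 R))° `&`
    (gamma R @` (B `&` tau6 R))° = set0.
  move=> AB; apply: disjoint_interior_isometry; first exact: isometry_gamma.
  by apply: (disjoint_interiorS _ _ AB); exact: subIsetl.
have D5 A B : A° `&` B° = set0 -> (A `&` tau5 R)° `&` (B `&` tau5 R)° = set0.
  by apply: disjoint_interiorS; exact: subIsetl.
have D57 A B : (A `&` tau5 R)° `&` (gamma R @` (B `&` tau6 R))° = set0.
  by apply: (disjoint_interiorS _ _ (disjoint_tau5_gamma R));
    [exact: subIsetr|apply: image_subset; exact: subIsetr].
apply: tilingP.
  move=> [[|[|[|[|[|[|//]]]]]] hi] [[|[|[|[|[|[|//]]]]]] hj] //= _;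
  rewrite !(tnth_nth set0) /=;
  by [exact: D57|rewrite setIC; exact: D57
     |apply: D5; exact: disjoint_alpha_tau2|apply: D5; exact: disjoint_alpha_beta
     |apply: D5; exact: disjoint_tau2_beta
     |apply: gD; exact: disjoint_alpha_tau2|apply: gD; exact: disjoint_alpha_beta
     |apply: gD; exact: disjoint_tau2_beta].
rewrite !bigcup_ord_recl bigcup_ord0 setU0 !(tnth_nth set0) /= /tau7.
set A := alpha R @` _; set B := beta R @` _.
rewrite [RHS](_ : _ = (A `|` tau2 R `|` B) `&` tau5 R `|`
  gamma R @` ((A `|` tau2 R `|` B) `&` tau6 R)).
  (* Gathers the three pieces in [tau5] before the three moved by [gamma]. *)
  have ac (a b c d e f : set 'rV[R]_4) :
      a `|` (b `|` (c `|` (d `|` (e `|` f)))) = a `|` c `|` e `|` (b `|` d `|` f).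
    by rewrite -!setUA (setUCA b) (setUCA d) (setUCA b).
  by rewrite !setIUl !image_setU ac.
by rewrite -/(tau4 R) !(setIidr (@subIsetl _ _ _)).
Qed.

End Tilings.

(** * Congruence of tau7 with the prism *)

Section Prism.
Variables (R : realType) (v1 v2 v3 : 'rV[R]_3) (a b : R).
Hypotheses (hv : hill_vectors v1 v2 v3) (hab : b - a = 2^-1).

Let s : R := Num.sqrt (3 / 4).

(* The vectors [s v1, s v2, s v3] and minus their sum have the Gram matrix of
   the projections of the standard basis of R^4 to [w + x + y + z = 0]; the last
   coordinate measures displacement along the unit normal (1,1,1,1)/2. *)
Definition to_prism (p : 'rV[R]_4) : 'rV[R]_4 :=
  row_mx (s *: ((wc p - zc p) *: v1 + (xc p - zc p) *: v2 + (yc p - zc p) *: v3))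
    (const_mx (a + (1 + wc p + xc p + yc p + zc p) / 2) : 'rV[R]_1).

Lemma dotv_row_mx m n (u u' : 'rV[R]_m) (v v' : 'rV[R]_n) :
  dotv (row_mx u v) (row_mx u' v') = dotv u u' + dotv v v'.
Proof. by rewrite !dotvE tr_row_mx mul_row_col mxE. Qed.

Lemma isometry_to_prism : euclidean_isometry to_prism.
Proof.
have unit_dotv (v : 'rV[R]_3) : enorm v = 1 -> dotv v v = 1.
  by move=> h; rewrite -[LHS](sqr_sqrtr (dotvv_ge0 v)) -/(enorm v) h expr1n.
case: hv => -[/unit_dotv n1 /unit_dotv n2 /unit_dotv n3] [d12 d13 d23].
apply/isometryP => p q.
(* The map is affine, so only the quadratic form of its linear part, evaluated at [p - q], remains
   to be checked. *)
have -> : to_prism p - to_prism q =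
    row_mx (s *: ((wc (p - q) - zc (p - q)) *: v1 + (xc (p - q) - zc (p - q)) *: v2
                  + (yc (p - q) - zc (p - q)) *: v3))
      (const_mx ((wc (p - q) + xc (p - q) + yc (p - q) + zc (p - q)) / 2) : 'rV[R]_1).
  rewrite /to_prism (@opp_row_mx _ 1 3 1) (@add_row_mx _ 1 3 1).
  by congr (@row_mx _ 1 3 1 _ _); apply/rowP => i; rewrite !coordB !mxE; ring.
move: (p - q) => d; rewrite (@dotv_row_mx 3 1) dotv4 dotvZl dotvZr mulrA.
have -> : s * s = 3 / 4 by rewrite -expr2 sqr_sqrtr // divr_ge0.
rewrite !(dotvDl, dotvDr, dotvZl, dotvZr) (dotvC v2 v1) (dotvC v3 v1) (dotvC v3 v2).
rewrite n1 n2 n3 d12 d13 d23 [X in _ + X]big_ord1 !mxE.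
by field.
Qed.

Lemma to_prism_tau7 :
  to_prism @` tau7 R = prism [set s *: u | u in P3 v1 v2 v3] `[a, b].
Proof.
apply/seteqP; split=> [_ [p /tau7P[h1 h2 h3 h4 /andP[h5 h6]] <-]|].
  exists (s *: ((wc p - zc p) *: v1 + (xc p - zc p) *: v2 + (yc p - zc p) *: v3)).
  exists (a + (1 + wc p + xc p + yc p + zc p) / 2); split=> //.
    exists ((wc p - zc p) *: v1 + (xc p - zc p) *: v2 + (yc p - zc p) *: v3) => //.
    by exists (wc p - zc p), (xc p - zc p), (yc p - zc p); split=> //; lra.
  have hab' := hab; rewrite /= in_itv /=; apply/andP; split; lra.
move=> x [u [t [[_ [l1 [l2 [l3 [k1 k2 k3 k4 ->]]]] <-]]]].
rewrite /= in_itv /= => /andP[ta tb] ->; have hab' := hab.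
(* Solves [t = a + (1 + 4 * z + l1 + l2 + l3) / 2], the height of the point with coordinates
   [z + l1], [z + l2], [z + l3], [z]. *)
pose z := (2 * (t - a) - 1 - l1 - l2 - l3) / 4.
exists (pt4 (z + l1) (z + l2) (z + l3) z).
  apply/tau7P; rewrite !pt4E; split; try lra.
  by apply/andP; rewrite /z; split; lra.
rewrite /to_prism !pt4E; congr (@row_mx _ 1 3 1 _ _).
  by congr (_ *: (_ *: _ + _ *: _ + _ *: _)); ring.
by congr (const_mx _); rewrite /z; field.
Qed.

End Prism.

(** * Assembly of the six-piece dissection *)

Unset Implicit Arguments.

Theorem mainTheorem5 (R : realType) (v1 v2 v3 : 'rV[R]_3) (a b : R)
    (hv : hill_vectors v1 v2 v3) (hab : b - a = 2^-1) :
  let target :=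
    prism [set Num.sqrt (3 / 4) *: u | u in P3 v1 v2 v3] `[a, b] in
  [/\ to_tau R @` O4 R = tau R,
      tau1 R (ptA R) /\ tau3 R (ptE R)
    & tiling (tau R) (tnth [tuple tau1 R; tau2 R; tau3 R])] /\
  [/\ euclidean_isometry (alpha R), euclidean_isometry (beta R) & euclidean_isometry (gamma R)] /\
  tiling (tau4 R)
    (tnth [tuple alpha R @` tau1 R; tau2 R; beta R @` tau3 R]) /\
  tiling (tau4 R) (tnth [tuple tau5 R; tau6 R]) /\
  tiling (tau7 R) (tnth [tuple tau5 R; gamma R @` tau6 R]) /\
  congruent (tau7 R) target /\
  exists phi : 'rV[R]_4 -> 'rV[R]_4,
    [/\ euclidean_isometry phi,
        phi @` tau7 R = target
      & dissection (O4 R) target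
          (fun i => to_tau R @^-1` tau_piece R i)
          (fun i => phi @` (final_motion R i @` tau_piece R i))
          (fun i => phi \o final_motion R i \o to_tau R)].
Proof.
move=> target.
pose phi := to_prism v1 v2 v3 a.
have isophi : euclidean_isometry phi by exact: isometry_to_prism.
have phi7 : phi @` tau7 R = target by exact: to_prism_tau7.
have isofinal i : euclidean_isometry (final_motion R i).
  have isoa := @isometry_alpha R; have isob := @isometry_beta R.
  have isog := @isometry_gamma R.
  case: i => [[|[|[|[|[|[|//]]]]]] hi]; rewrite /final_motion (tnth_nth id) //=;
    exact: isometry_comp.
have [g [isog tauK gK]] := isometry_inv (@isometry_to_tau R).
have preim A : to_tau R @^-1` A = g @` A by rewrite (image_cancel _ gK tauK).
have O4E : O4 R = g @` tau R.
  by rewrite -to_tau_O4 image_comp (_ : g \o _ = id) ?image_id //; exact/funext.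
have polQ i : polytope (phi @` (final_motion R i @` tau_piece R i)).
  by do 2!apply: polytope_isometry => //; exact: polytope_tau_piece.
have tilQ := tiling_isometry isophi (@tiling_final_piece R).
split; first split; [exact: to_tau_O4| |exact: tiling_tau|].
  by split; [exact: ptA_tau1|exact: ptE_tau3].
split; first by split; [exact: isometry_alpha|exact: isometry_beta|exact: isometry_gamma].
split; first exact: tiling_tau4.
split; first exact: tiling_tau4_cut.
split; first exact: tiling_tau7.
split; first by exists phi.
exists phi; split=> //; split.
- split; first by rewrite O4E; apply: polytope_isometry => //; exact: polytope_tau.
  (* The prism is a polytope because it is the union of the six moved pieces; no direct
     triangulation is made. *)
  by rewrite -phi7; have [_ <-] := tilQ; exact: polytope_bigcup.
- move=> i; split=> //.
  by rewrite preim; apply: polytope_isometry => //; exact: polytope_tau_piece.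
- rewrite O4E (funext (fun i => preim (tau_piece R i))).
  exact/tiling_isometry/tiling_tau_piece.
- by rewrite -phi7.
- move=> i; split.
    by apply: isometry_comp; [exact: isometry_comp|exact: isometry_to_tau].
  apply/seteqP; split=> [_ [x px <-]|_ [_ [x px <-] <-]].
    by exists (final_motion R i (to_tau R x)) => //; exists (to_tau R x).
  by exists (g x); rewrite /= gK.
Qed.
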